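(* Let $\mathbf{Q}\in\mathbb{C}^{N\times N_d}$ be a fixed DMA weight matrix, let $P_{\max}>0$, and let $$\mathbf{G}(\mathbf{Q})=\zeta\sum_{m=1}^{M}\alpha_m\,\mathbf{Q}^H\mathbf{H}^H\mathbf{a}_m\mathbf{a}_m^H\mathbf{H}\mathbf{Q}\in\mathbb{C}^{N_d\times N_d},$$ with nonnegative weights $\alpha_1,\dots,\alpha_M\ge 0$. Consider the optimization problem over $\mathbf{w}_1,\dots,\mathbf{w}_M\in\mathbb{C}^{N_d}$: $$\max_{\{\mathbf{w}_j\}}\ \sum_{j=1}^{M}\mathbf{w}_j^H\,\mathbf{G}(\mathbf{Q})\,\mathbf{w}_j\quad\text{s.t.}\quad \sum_{j=1}^{M}\|\mathbf{w}_j\|^2\le P_{\max}.$$ Let $\mathbf{w}^*(\mathbf{Q})$ be a unit-norm eigenvector of $\mathbf{G}(\mathbf{Q})$ corresponding to its maximal eigenvalue. Then, for any nonnegative reals $p_1,\dots,p_M$ with $\sum_{j=1}^M p_j=P_{\max}$, the choice $\mathbf{w}_j=\sqrt{p_j}\,\mathbf{w}^*(\mathbf{Q})$, $j=1,\dots,M$, attains the maximum of this problem.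
   Context: $N_d,N_e,M\ge 1$ are integers (numbers of microstrips, of elements per microstrip, and of energy receivers) and $N=N_dN_e$. $\|\cdot\|$ is the $\ell_2$ norm, $(\cdot)^H$ the Hermitian transpose, and $j$ (when not an index) is the imaginary unit. $0<\zeta<1$ is the energy conversion efficiency and $\alpha_1,\dots,\alpha_M$ are predefined real weights. DMA weight matrix: $\mathbf{Q}\in\mathbb{C}^{N\times N_d}$ has entries $\mathbf{Q}_{(i-1)N_e+l,\,n}=q_{i,l}$ if $i=n$ and $0$ if $i\ne n$ (for $1\le i,n\le N_d$, $1\le l\le N_e$), where each $q_{i,l}\in\mathcal{Q}=\{\tfrac{j+e^{j\phi}}{2}:\phi\in[0,2\pi]\}$. $\mathbf{H}\in\mathbb{C}^{N\times N}$ is the diagonal matrix whose $((i-1)N_e+l)$-th diagonal entry is $h_{i,l}=e^{-\rho_{i,l}(\alpha_{\rm c}+j\beta_{\rm c})}$, with real constants $\alpha_{\rm c},\beta_{\rm c}$ and real $\rho_{i,l}$ (location of the $l$-th element in the $i$-th microstrip). Channel vectors: element $(i,l)$ is located at $\mathbf{p}_{i,l}=(x_i,y_l,0)\in\mathbb{R}^3$ and receiver $m$ at $\mathbf{p}_m\in\mathbb{R}^3$; $d_{i,l,m}=|\mathbf{p}_m-\mathbf{p}_{i,l}|>0$. With wavelength $\lambda>0$ and $k=2\pi/\lambda$, $\mathbf{a}_m\in\mathbb{C}^N$ is the column vector for which $\mathbf{a}_m^H$ is the row vector with $((i-1)N_e+l)$-th entry $A_{i,l}(\mathbf{p}_m)e^{-jkd_{i,l,m}}$,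 where $A_{i,l}(\mathbf{p}_m)=\sqrt{F(\Theta_{i,l,m})}\,\frac{\lambda}{4\pi d_{i,l,m}}$ and $\Theta_{i,l,m}=(\theta_{i,l,m},\phi_{i,l,m})$ is the elevation-azimuth pair from element $(i,l)$ to receiver $m$. The radiation profile is $F(\Theta_{i,l,m})=2(b+1)\cos^b(\theta_{i,l,m})$ if $\theta_{i,l,m}\in[0,\pi/2]$ and $0$ otherwise, with boresight gain constant $b$ (e.g. $b=2$). *)

(* Defs.v *)
From HB Require Import structures.
From mathcomp Require Import all_boot all_order all_algebra.
From mathcomp Require Import all_classical all_reals all_analysis.
From mathcomp Require Export complex.

Set Implicit Arguments.
Unset Strict Implicit.
Unset Printing Implicit Defensive.

Import Order.TTheory GRing.Theory Num.Theory.
Local Open Scope classical_set_scope.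
Local Open Scope ring_scope.
Local Open Scope sesquilinear_scope.
Local Open Scope complex_scope.

(* The complex numbers are R[i], with R : realType.  The order of R[i] is
   partial: u <= v means that v - u is a nonnegative real.  The imaginary unit
   is 'i%C = 0 +i* 1. *)

Definition cexp (R : realType) (z : R[i]) : R[i] :=
  let: a +i* b := z in (expR a)%:C * (cos b +i* sin b).

(* The norm that MathComp-Analysis puts on matrices is the sup norm, hence
   these Euclidean norms. *)
Definition l2norm (R : realType) n (v : 'cV[R[i]]_n) : R :=
  Num.sqrt (\sum_i ComplexField.Normc.normc (v i 0) ^+ 2).

Definition enorm (R : realType) n (v : 'rV[R]_n) : R :=
  Num.sqrt (\sum_i v 0 i ^+ 2).

Lemma index_allpairs (S T : eqType) (s : seq S) (t : seq T) x y :
  x \in s -> y \in t ->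
  index (x, y) [seq (a, b) | a <- s, b <- t]
  = (index x s * size t + index y t)%N.
Proof.
move=> + yt; elim: s => //= a s IHs; rewrite in_cons index_cat.
have [<- _|a_neq /=] := eqVneq a x.
  by rewrite map_f // index_map // => ? ? [].
rewrite ifN => [xs|].
  by rewrite IHs ?size_map ?mulSn ?addnA // -(eqP xs) eqxx in a_neq *.
by apply/mapP => -[b _ [xa _]]; rewrite xa eqxx in a_neq.
Qed.

(* Element l of microstrip i has index mxvec_index i l : 'I_(Nd * Ne), so that
   the row mxvec A carries A i l at that index.  With indices starting at 0,
   mxvec is row-major, i.e. the index is i * Ne + l: *)
Lemma val_mxvec_index (Nd Ne : nat) (i : 'I_Nd) (l : 'I_Ne) :
  mxvec_index i l = (i * Ne + l)%N :> nat.
Proof.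
rewrite /= -[LHS](index_uniq (i, l) _ (enum_uniq predT)) -?cardE //.
rewrite -enum_val_nth enum_rankK.
rewrite enumT unlock /= /prod_enum index_allpairs ?mem_enum //.
by rewrite size_enum_ord !index_enum_ord.
Qed.

Definition lorentzian (R : realType) : set R[i] :=
  [set z | exists2 phi : R, 0 <= phi <= 2 * pi
         & z = ('i%C + cexp ('i%C * phi%:C)) / 2].

(* Column n of Q holds the weights of microstrip n, and 0 elsewhere. *)
Definition dma_matrix (R : realType) Nd Ne (q : 'I_Nd -> 'I_Ne -> R[i]) :
    'M[R[i]]_(Nd * Ne, Nd) :=
  (\matrix_(n < Nd) mxvec (\matrix_(i, l) if i == n then q i l else 0))^T.

Definition microstrip_matrix (R : realType) Nd Ne (alphac betac : R)
    (rho : 'I_Nd -> 'I_Ne -> R) : 'M[R[i]]_(Nd * Ne) :=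
  diag_mx (mxvec (\matrix_(i, l)
    cexp (- ((rho i l)%:C * (alphac%:C + 'i%C * betac%:C))))).

Definition row3 (R : realType) (x y z : R) : 'rV[R]_3 :=
  \row_(k < 3) [:: x; y; z]`_k.

Definition element_pos (R : realType) Nd Ne (x : 'I_Nd -> R) (y : 'I_Ne -> R)
    (i : 'I_Nd) (l : 'I_Ne) : 'rV[R]_3 :=
  row3 (x i) (y l) 0.

(* The elements lie in the plane z = 0, with boresight the positive z-axis.
   The radiation profile is maximal at theta = 0, so theta is measured from
   the boresight.  The azimuth is determined up to a multiple of 2 * pi (and
   is arbitrary on the z-axis). *)
Definition elevation_azimuth (R : realType) (v : 'rV[R]_3) (Theta : R * R) :
    Prop :=
  let: (theta, phi) := Theta in
  0 <= theta <= pi /\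
  v = enorm v *: row3 (sin theta * cos phi) (sin theta * sin phi) (cos theta).

Definition radiation_profile (R : realType) (b : R) (Theta : R * R) : R :=
  if 0 <= Theta.1 <= pi / 2 then 2 * (b + 1) * cos Theta.1 `^ b else 0.

(* The gain at distance d. *)
Definition channel_gain (R : realType) (lambda b : R) (Theta : R * R) (d : R) :
    R :=
  Num.sqrt (radiation_profile b Theta) * (lambda / (4 * pi * d)).

(* The channel vector a of a receiver at p; the inner row is a^H. *)
Definition channel_vector (R : realType) Nd Ne (lambda b : R)
    (x : 'I_Nd -> R) (y : 'I_Ne -> R) (p : 'rV[R]_3)
    (Theta : 'I_Nd -> 'I_Ne -> R * R) : 'cV[R[i]]_(Nd * Ne) :=
  let k := 2 * pi / lambda in
  let d i l := enorm (p - element_pos x y i l) in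
  (mxvec (\matrix_(i, l) ((channel_gain lambda b (Theta i l) (d i l))%:C *
                          cexp (- ('i%C * (k * d i l)%:C)))))^t*.

Definition harvest_matrix (R : realType) N Nd M (zeta : R) (alpha : 'I_M -> R)
    (a : 'I_M -> 'cV[R[i]]_N) (H : 'M[R[i]]_N) (Q : 'M[R[i]]_(N, Nd)) :
    'M[R[i]]_Nd :=
  zeta%:C *: \sum_(m < M) (alpha m)%:C *:
    (Q^t* *m H^t* *m a m *m (a m)^t* *m H *m Q).

Definition objective (R : realType) Nd M (G : 'M[R[i]]_Nd)
    (w : 'I_M -> 'cV[R[i]]_Nd) : R[i] :=
  \sum_(j < M) ((w j)^t* *m G *m w j) 0 0.

Definition feasible (R : realType) Nd M (Pmax : R)
    (w : 'I_M -> 'cV[R[i]]_Nd) : Prop :=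
  \sum_(j < M) l2norm (w j) ^+ 2 <= Pmax.

Definition attains_max (R : realType) Nd M (G : 'M[R[i]]_Nd) (Pmax : R)
    (w : 'I_M -> 'cV[R[i]]_Nd) : Prop :=
  feasible Pmax w /\
  forall w' : 'I_M -> 'cV[R[i]]_Nd,
    feasible Pmax w' -> objective G w' <= objective G w.

(* eigenvalue refers to row vectors, but the spectrum is the same for columns.
   The maximum is for the order of R[i]: the eigenvalues of a Hermitian matrix
   are real, hence comparable. *)
Definition max_eigenvalue (R : realType) n (G : 'M[R[i]]_n) (mu : R[i]) :
    Prop :=
  eigenvalue G mu /\ forall nu, eigenvalue G nu -> nu <= mu.

Definition unit_eigenvector (R : realType) n (G : 'M[R[i]]_n) (mu : R[i])
    (w : 'cV[R[i]]_n) : Prop :=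
  l2norm w = 1 /\ G *m w = mu *: w.

(* Main.v *)
(* G is a nonnegative combination of Gram matrices, hence Hermitian positive
   semidefinite.  Diagonalizing G in a unitary basis gives the Rayleigh bound
   w^H G w <= mu ||w||^2, so every feasible point has objective at most
   mu * sum_j ||w_j||^2 <= mu * Pmax, where the last step uses mu >= 0.  The
   points sqrt(p_j) w* reach mu * Pmax whatever the power split. *)

Require Import Defs.
From mathcomp Require Import all_boot all_order all_algebra.
From mathcomp Require Import all_classical all_reals all_analysis.

Set Implicit Arguments.
Unset Strict Implicit.
Unset Printing Implicit Defensive.

Import Order.TTheory GRing.Theory Num.Theory.
Local Open Scope ring_scope.
Local Open Scope complex_scope.
Local Open Scope sesquilinear_scope.

Lemma trmxC_mul (C : numClosedFieldType) m n p (A : 'M[C]_(m, n))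
    (B : 'M[C]_(n, p)) :
  (A *m B)^t* = B^t* *m A^t*.
Proof. by rewrite trmx_mul map_mxM. Qed.

Lemma mulmx_trmxC_self (C : numClosedFieldType) n (v : 'cV[C]_n) :
  (v^t* *m v) 0 0 = \sum_i `|v i 0| ^+ 2.
Proof. by rewrite mxE; apply: eq_bigr => i _; rewrite !mxE normCKC. Qed.

Lemma quad_formZ (C : numClosedFieldType) n (G : 'M[C]_n) (c : C)
    (v : 'cV[C]_n) :
  ((c *: v)^t* *m G *m (c *: v)) 0 0 = `|c| ^+ 2 * (v^t* *m G *m v) 0 0.
Proof.
by rewrite [(c *: v)^T]linearZ map_mxZ /= -!scalemxAl -scalemxAr scalerA mxE normCKC.
Qed.

(** In the coordinates [P *m v] of a unitary eigenbasis, the form becomes the sum of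
    [d 0 i * |(P *m v) i 0| ^+ 2], and each [d 0 i] is an eigenvalue, hence at most [mu]. *)
Lemma rayleigh_le (C : numClosedFieldType) n (G : 'M[C]_n) (mu : C)
    (v : 'cV[C]_n) :
  G \is hermsymmx -> (forall nu, eigenvalue G nu -> nu <= mu) ->
  (v^t* *m G *m v) 0 0 <= mu * (v^t* *m v) 0 0.
Proof.
move=> /hermitian_normalmx/orthomx_spectralP GE mu_max.
have Pu := spectral_unitarymx G; have Punit := spectral_unit G.
set P := spectralmx G in GE Pu Punit; set d := spectral_diag G in GE.
have d_le i : d 0 i <= mu.
  (* From [P *m G = diag_mx d *m P], row [i] of [P] is a left eigenvector for [d 0 i]; it is nonzero
     because [P] is invertible. *)
  apply: mu_max; apply/eigenvalueP; exists (row i P).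
    rewrite {1}GE -row_mul !mulmxA mulmxV // mul1mx.
    by apply/rowP => j; rewrite mul_diag_mx !mxE.
  rewrite rowE mul_mx_rowfree_eq0 ?row_free_unit //.
  by apply/eqP => /rowP/(_ i)/eqP; rewrite !mxE !eqxx oner_eq0.
(* Both sides are passed to the eigenbasis, so that they can be compared coordinate by
   coordinate. *)
have -> : v^t* *m v = (P *m v)^t* *m (P *m v).
  by rewrite trmxC_mul mulmxA mulmxKtV.
have -> : v^t* *m G *m v = (P *m v)^t* *m (diag_mx d *m (P *m v)).
  by rewrite {1}GE invmx_unitary // trmxC_mul !mulmxA.
rewrite mulmx_trmxC_self mxE mulr_sumr; apply: ler_sum => i _.
rewrite mul_diag_mx !mxE mulrCA -normCKC.
by apply: ler_wpM2r; rewrite ?exprn_ge0.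
Qed.

Section GramSum.
Context (C : numClosedFieldType) (n r M : nat) (c : C) (k : 'I_M -> C).
Context (B : 'I_M -> 'M[C]_(r, n)).
Context (c_ge0 : 0 <= c) (k_ge0 : forall m, 0 <= k m).

Let G := c *: \sum_(m < M) k m *: ((B m)^t* *m B m).

Lemma gram_sum_hermsym : G \is hermsymmx.
Proof.
apply/is_hermitianmxP; rewrite expr0 scale1r /G linearZ map_mxZ /=.
rewrite conj_Creal ?ger0_real // [X in X ^ _](linear_sum trmx) map_mx_sum.
congr (_ *: _); apply: eq_bigr => m _.
by rewrite linearZ map_mxZ /= conj_Creal ?ger0_real // trmxC_mul trmxCK.
Qed.

(** Each term contributes [k m] times the squared Euclidean norm of [B m *m v]. *)
Lemma gram_sum_ge0 (v : 'cV[C]_n) : 0 <= (v^t* *m G *m v) 0 0.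
Proof.
rewrite -scalemxAr -scalemxAl mxE mulr_ge0 //.
rewrite mulmx_sumr mulmx_suml summxE; apply: sumr_ge0 => m _.
rewrite -scalemxAr -scalemxAl mxE mulr_ge0 //.
rewrite mulmxA -trmxC_mul -mulmxA mulmx_trmxC_self.
by apply: sumr_ge0 => i _; rewrite exprn_ge0.
Qed.

End GramSum.

(** The rank-one factor [a m *m (a m)^t*] splits in the middle, so each summand is the Gram matrix
    of the row [(a m)^t* *m H *m Q]. *)
Lemma harvest_matrix_gram (R : realType) (N Nd M : nat) (zeta : R)
    (alpha : 'I_M -> R) (a : 'I_M -> 'cV[R[i]]_N) (H : 'M[R[i]]_N)
    (Q : 'M[R[i]]_(N, Nd)) (B := fun m => (a m)^t* *m H *m Q) :
  harvest_matrix zeta alpha a H Q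
  = zeta%:C *: \sum_(m < M) (alpha m)%:C *: ((B m)^t* *m B m).
Proof. by under [in RHS]eq_bigr => m _ do rewrite !trmxC_mul trmxCK !mulmxA. Qed.

Lemma l2norm_sqrE (R : realType) n (v : 'cV[R[i]]_n) :
  (l2norm v ^+ 2)%:C = (v^t* *m v) 0 0.
Proof.
rewrite sqr_sqrtr ?sumr_ge0 // => [|i _]; last exact: sqr_ge0.
rewrite mulmx_trmxC_self rmorph_sum; apply: eq_bigr => i _.
by rewrite rmorphXn.
Qed.

Theorem proposition1 (R : realType) (Nd Ne M : nat)
    (Nd_gt0 : (0 < Nd)%N) (Ne_gt0 : (0 < Ne)%N) (M_gt0 : (0 < M)%N)
    (zeta : R) (zeta_gt0 : 0 < zeta) (zeta_lt1 : zeta < 1)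
    (alpha : 'I_M -> R) (alpha_ge0 : forall m, 0 <= alpha m)
    (q : 'I_Nd -> 'I_Ne -> R[i])
    (q_lorentzian : forall i l, lorentzian (q i l))
    (alphac betac : R) (rho : 'I_Nd -> 'I_Ne -> R)
    (x : 'I_Nd -> R) (y : 'I_Ne -> R) (p_rx : 'I_M -> 'rV[R]_3)
    (dist_gt0 : forall i l m, 0 < enorm (p_rx m - element_pos x y i l))
    (lambda : R) (lambda_gt0 : 0 < lambda) (b : R)
    (Theta : 'I_Nd -> 'I_Ne -> 'I_M -> R * R)
    (ThetaP : forall i l m,
      elevation_azimuth (p_rx m - element_pos x y i l) (Theta i l m))
    (Pmax : R) (Pmax_gt0 : 0 < Pmax) :
  let Q := dma_matrix q in
  let H := microstrip_matrix alphac betac rho in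
  let a m := channel_vector lambda b x y (p_rx m)
                            (fun i l => Theta i l m) in
  let G := harvest_matrix zeta alpha a H Q in
  forall (mu : R[i]) (wstar : 'cV[R[i]]_Nd),
    max_eigenvalue G mu -> unit_eigenvector G mu wstar ->
  forall p : 'I_M -> R,
    (forall j, 0 <= p j) -> \sum_(j < M) p j = Pmax ->
    attains_max G Pmax (fun j => (Num.sqrt (p j))%:C *: wstar).
Proof.
move=> Q H a G mu w [_ mu_max] [w1 Gw] p p_ge0 p_sum.
have Gherm : G \is hermsymmx.
  rewrite /G harvest_matrix_gram.
  by apply: gram_sum_hermsym => [|m]; rewrite ler0c // ltW.
have ww : (w^t* *m w) 0 0 = 1 by rewrite -l2norm_sqrE w1 expr1n.
have Gww : (w^t* *m G *m w) 0 0 = mu.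
  by rewrite -mulmxA Gw -scalemxAr mxE ww mulr1.
(* [mu] is the value at [w] of a positive semidefinite form. *)
have mu_ge0 : 0 <= mu.
  rewrite -Gww /G harvest_matrix_gram.
  by apply: gram_sum_ge0 => [|m]; rewrite ler0c // ltW.
(* [A] is left free: [A = 1] yields the power spent by the [j]-th vector, [A = G] its share of the
   objective. *)
have pwE j (A : 'M[R[i]]_Nd) : (((Num.sqrt (p j))%:C *: w)^t* *m A *m
    ((Num.sqrt (p j))%:C *: w)) 0 0 = (p j)%:C * (w^t* *m A *m w) 0 0.
  by rewrite quad_formZ normc_def /= expr0n addr0 sqrtr_sqr -rmorphXn real_normK
    ?num_real // sqr_sqrtr.
split.
  rewrite /feasible -p_sum; apply: ler_sum => j _.
  by rewrite -lecR l2norm_sqrE -[X in X *m _]mulmx1 pwE mulmx1 ww mulr1.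
move=> w' w'_feas.
have -> : objective G (fun j => (Num.sqrt (p j))%:C *: w) = Pmax%:C * mu.
  rewrite -p_sum rmorph_sum mulr_suml; apply: eq_bigr => j _.
  by rewrite pwE Gww.
have objective_le : objective G w' <= (\sum_(j < M) l2norm (w' j) ^+ 2)%:C * mu.
  rewrite rmorph_sum mulr_suml; apply: ler_sum => j _.
  by rewrite [X in X * _]l2norm_sqrE mulrC rayleigh_le.
(* The power budget may be multiplied by [mu] because [mu] is nonnegative. *)
by apply: (le_trans objective_le); rewrite ler_wpM2r // lecR.
Qed.
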